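(* Let $\sigma=\sigma_1\cdots\sigma_m$ be a permutation with $r$ descents and $\pi=\pi_1\cdots\pi_n$ a permutation with $s$ descents, with no letters in common, and let $\alpha$ be a shuffle of $\sigma$ and $\pi$ with exactly $k$ descents. Let $(\lambda,\mu)=\Phi(\alpha)$ be defined as below. Then $\lambda\in P_{k-r}(k-s,m)$ and $\mu\in P_{\le n-k+r}(k-s)$, and \[{\rm maj}(\alpha)=|\lambda|+|\mu|+{\rm maj}(\sigma)+{\rm maj}(\pi).\]
   Context: A permutation of length $n$ is a sequence of $n$ distinct letters from a totally ordered set. An index $i$ is a descent of $\pi$ if $1\le i\le n-1$ and $\pi_i>\pi_{i+1}$; ${\rm des}(\pi)$ is the number of descents and ${\rm maj}(\pi)$ the sum of the descents; $d_i(\pi)$ denotes the number of descents of $\pi$ that are $\ge i$. A shuffle of disjoint $\sigma,\pi$ is a permutation of length $m+n$ containing both as subsequences. Definition of $\Phi$: for $0\le i\le n$ let $\alpha^{(i)}$ be the permutation obtained from $\alpha$ by deleting $\pi_1,\dots,\pi_i$ (so $\alpha^{(0)}=\alpha$, $\alpha^{(n)}=\sigma$). For $1\le i\le n$ set $t(i)={\rm maj}(\alpha^{(i-1)})-{\rm maj}(\alpha^{(i)})-d_i(\pi)$. Let $i_1<\cdots<i_{k-r}$ be the indices $i\in\{1,\dots,n\}$ with ${\rm des}(\alpha^{(i-1)})={\rm des}(\alpha^{(i)})+1$ (there are exactly $k-r$ of them), and let $j_1<\cdots<j_{n-k+r}$ be the remaining indices in $\{1,\dots,n\}$ (for which ${\rm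 des}(\alpha^{(j-1)})={\rm des}(\alpha^{(j)})$). Then $\lambda=(t(i_{k-r}),t(i_{k-r-1}),\ldots,t(i_1))$ and $\mu=(t(j_1),t(j_2),\ldots,t(j_{n-k+r}))$. For integers $j,t,N$: $P_j(t,N)$ is the set of nonincreasing integer sequences of length exactly $j$ with all entries in $[t,N]$; $P_{\le j}(N)$ is the set of partitions with at most $j$ parts and largest part at most $N$ (equivalently, nonincreasing sequences of length $j$ with entries in $\{0,\dots,N\}$; here $\mu$ is identified with such a sequence). $|\cdot|$ denotes the sum of entries. *)

(* Defs.v *)
From HB Require Import structures.
From mathcomp Require Export all_boot all_order all_algebra.
Set Implicit Arguments.
Unset Strict Implicit.
Unset Printing Implicit Defensive.
Import Order.TTheory GRing.Theory Num.Theory.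

Local Open Scope ring_scope.

Section Descents.
Context {d : Order.disp_t} {T : orderType d}.
Implicit Types (w p a : seq T) (i : nat).

(* Positions are numbered from 1, so w_i is [nth x0 w i.-1]; the default value
   x0 is never reached. *)
Definition is_descent w i : bool :=
  if w is x0 :: _ then
    (1 <= i < size w)%N && (nth x0 w i < nth x0 w i.-1)%O
  else false.

Definition descents w : seq nat := [seq i <- iota 1 (size w).-1 | is_descent w i].

Definition des w : nat := size (descents w).

Definition maj w : nat := (\sum_(i <- descents w) i)%N.

Definition des_from i w : nat := count (fun j => i <= j)%N (descents w).

Definition is_shuffle w p a : bool :=
  [&& uniq a, size a == (size w + size p)%N, subseq w a & subseq p a].

(* The word alpha^(i). *)
Definition del_prefix p a i : seq T := [seq x <- a | x \notin take i p].

Definition Phi_t p a i : int :=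
  (maj (del_prefix p a i.-1))%:Z - (maj (del_prefix p a i))%:Z
  - (des_from i p)%:Z.

Definition drops_des p a i : bool :=
  des (del_prefix p a i.-1) == (des (del_prefix p a i)).+1.

Definition Phi p a : seq int * seq int :=
  let I := [seq i <- iota 1 (size p) | drops_des p a i] in
  let J := [seq i <- iota 1 (size p) | ~~ drops_des p a i] in
  ([seq Phi_t p a i | i <- rev I], [seq Phi_t p a j | j <- J]).

End Descents.

(* P_j(t, N) *)
Definition Pseq (j t N : int) : {pred seq int} :=
  [pred s | [&& (size s)%:Z == j, sorted >=%R s & all (fun x => t <= x <= N) s]].

(* P_{<= j}(N), each partition being padded with zeros to length exactly j. *)
Definition Pseq_le (j N : int) : {pred seq int} :=
  [pred s | [&& (size s)%:Z == j, sorted >=%R s & all (fun x => 0 <= x <= N) s]].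

(* Main.v *)
Require Import Defs.
From mathcomp Require Import all_boot all_order all_algebra.
From mathcomp Require Import zify.
Set Implicit Arguments.
Unset Strict Implicit.
Unset Printing Implicit Defensive.
Import Order.TTheory GRing.Theory Num.Theory.
Local Open Scope ring_scope.

(** Inserting a letter x between u and v raises des by some e in {0, 1} and maj
    by des (x v) + e |u|.  Hence t(i) = f_i + e_i p_i, where p_i is the number of
    letters of sigma before pi_i and f_i is des of the suffix of alpha starting
    at pi_i minus des of the suffix of pi starting at pi_i.  As inserting a block
    of l letters raises des by an amount between 0 and l, f_i is nonincreasing
    and f_i + p_i is nondecreasing in i; the extreme values give the bounds, and
    summing the increments of maj gives the last identity. *)

(** * Descents and major index under insertion of letters *)

Section Insertion.
Context {d : Order.disp_t} {T : orderType d}.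
Implicit Types (x y : T) (u v w p a g : seq T).

Definition descent_before x w : bool := if w is y :: _ then (y < x)%O else false.

Lemma descents_cons x w :
  descents (x :: w) =
  (if descent_before x w then [:: 1%N] else [::]) ++ map succn (descents w).
Proof.
case: w => [|y w]; first by [].
rewrite /descents /= -/(iota 2 (size w)) (iotaDl 1 1) filter_map.
have -> : [seq i <- iota 1 (size w) | preim (addn 1) (is_descent [:: x, y & w]) i]
        = [seq i <- iota 1 (size w) | is_descent (y :: w) i].
  apply: eq_in_filter => -[|i]; rewrite mem_iota //= add1n ltnS => lti.
  by rewrite !ltnS /= (set_nth_default y) ?(set_nth_default y x) //=; lia.
by rewrite /is_descent /=; case: ifP.
Qed.

Lemma des_cons x w : des (x :: w) = (descent_before x w + des w)%N.
Proof. by rewrite /des descents_cons size_cat size_map; case: descent_before. Qed.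

(** Each descent of [w] moves one place to the right, and a new descent can only be at position 1,
    where it counts 1. *)
Lemma maj_cons x w : maj (x :: w) = (maj w + des (x :: w))%N.
Proof.
rewrite /maj des_cons /des descents_cons big_cat big_map /=.
have -> : (\sum_(i <- descents w) i.+1 = \sum_(i <- descents w) i + size (descents w))%N.
  by elim: (descents w) => [|i s IHs]; rewrite ?big_nil // !big_cons IHs /=; lia.
by case: descent_before; rewrite ?big_nil ?big_seq1; lia.
Qed.

Lemma des_from1 w : des_from 1 w = des w.
Proof.
rewrite /des_from /des -[RHS]count_predT; apply: eq_in_count => i.
by rewrite mem_filter mem_iota => /and3P[].
Qed.

Lemma des_from_cons x w i : (0 < i)%N -> des_from i.+1 (x :: w) = des_from i w.
Proof.
move=> i_gt0; rewrite /des_from descents_cons count_cat count_map.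
suff -> : count (leq i.+1) (if descent_before x w then [:: 1%N] else [::]) = 0%N by [].
by case: ifP => //= _; lia.
Qed.

(** Induction on [u]. Prepending a letter to a nonempty [u] keeps [e], as that letter is followed by
    the same one in both words, and [maj_cons] adds one more [e] to the difference of [maj]. Only
    the first prepended letter can change [e]. *)
Lemma des_maj_insert u x v :
  exists e : bool, des (u ++ x :: v) = (e + des (u ++ v))%N /\
    maj (u ++ x :: v) = (maj (u ++ v) + des (x :: v) + e * size u)%N.
Proof.
elim: u => [|y u [e [desE majE]]] /=.
  by exists (descent_before x v); rewrite des_cons maj_cons des_cons; split; lia.
case: u desE majE => [|z u] desE majE.
  suff [e' e'E] : exists e' : bool, des [:: y, x & v] = (e' + des (y :: v))%N.
    by exists e'; split=> //; rewrite /= !(maj_cons y) (maj_cons x) e'E; lia.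
  rewrite !des_cons /=; case: v {desE majE} => [|z v] /=.
    by exists (x < y)%O; lia.
  (* For consecutive letters y, x, z the number [y > x] + [x > z] - [y > z] is 0 or 1; two of the
     eight order patterns contradict transitivity. *)
  case: (ltP x y) => hxy; case: (ltP z x) => hzx; case: (ltP z y) => hzy.
  - by exists true; lia.
  - by have := lt_le_trans (lt_trans hzx hxy) hzy; rewrite ltxx.
  - by exists false; lia.
  - by exists true; lia.
  - by exists false; lia.
  - by exists true; lia.
  - by have := lt_le_trans hzy (le_trans hxy hzx); rewrite ltxx.
  - by exists false; lia.
exists e; have desE' : des (y :: (z :: u) ++ x :: v)
                     = (e + des (y :: (z :: u) ++ v))%N.
  by rewrite !(des_cons y) desE /=; lia.
by split=> //; rewrite !(maj_cons y) desE' majE /=; lia.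
Qed.

Lemma des_insert_seq u v g :
  (des (u ++ g) <= des (u ++ v ++ g) <= size v + des (u ++ g))%N.
Proof.
elim: v => [|x v IHv] /=; first by rewrite leqnn.
by have [e [-> _]] := des_maj_insert u x (v ++ g); lia.
Qed.

(** * Recursion for Phi on the first letter of pi *)

Lemma del_prefix0 p a : del_prefix p a 0 = a.
Proof. by rewrite /del_prefix take0; apply/all_filterP/allP. Qed.

Lemma del_prefix_cons x p a i :
  del_prefix (x :: p) a i.+1 = del_prefix p [seq y <- a | y != x] i.
Proof.
rewrite /del_prefix -filter_predI; apply: eq_filter => y.
by rewrite /= inE negb_or andbC.
Qed.

(** Deleting [x] shifts all indices by one, so only the entry for index 1 is new. It comes last in
    lambda, which lists its indices in reverse, or first in mu. *)
Lemma Phi_cons x p a (a' := [seq y <- a | y != x])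
    (t := (maj a)%:Z - (maj a')%:Z - (des (x :: p))%:Z) :
  Phi (x :: p) a = if des a == (des a').+1
                   then (rcons (Phi p a').1 t, (Phi p a').2)
                   else ((Phi p a').1, t :: (Phi p a').2).
Proof.
have drops1 : drops_des (x :: p) a 1 = (des a == (des a').+1).
  by rewrite /drops_des del_prefix_cons !del_prefix0.
have t1 : Phi_t (x :: p) a 1 = t.
  by rewrite /Phi_t del_prefix_cons !del_prefix0 des_from1.
have dropsS i : i \in iota 1 (size p) ->
    drops_des (x :: p) a i.+1 = drops_des p a' i.
  by case: i => [|i]; rewrite mem_iota // => _; rewrite /drops_des !del_prefix_cons.
have dropsCS i : i \in iota 1 (size p) ->
    ~~ drops_des (x :: p) a i.+1 = ~~ drops_des p a' i.
  by move=> /dropsS ->.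
have tS i : i \in iota 1 (size p) -> Phi_t (x :: p) a i.+1 = Phi_t p a' i.
  by case: i => [|i]; rewrite mem_iota // => _; rewrite /Phi_t !del_prefix_cons des_from_cons.
rewrite /Phi /= -/(iota 2 (size p)) (iotaDl 1 1) !filter_map drops1.
rewrite (eq_in_filter dropsS) (eq_in_filter dropsCS).
have tmap (P : pred nat) :
    [seq Phi_t (x :: p) a (1 + i)%N | i <- iota 1 (size p) & P i]
    = [seq Phi_t p a' i | i <- iota 1 (size p) & P i].
  by apply/eq_in_map => i; rewrite mem_filter => /andP[_ /tS].
case: ifP => _ /=; rewrite ?rev_cons ?map_rcons -!map_rev -!map_comp /= t1;
  by rewrite !map_rev !tmap.
Qed.

End Insertion.

(** * Cutting a shuffle at the letters of pi *)

Section Blocks.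
Context {d : Order.disp_t} {T : orderType d}.
Implicit Types (u a : seq T) (b : T * seq T) (bs : seq (T * seq T)).

(* A shuffle alpha is written u ++ block_word bs: the letters of pi are the first
   components of bs, each followed by the run of letters of sigma after it, and u
   is the run of letters of sigma before pi_1. *)
Definition block_word bs : seq T := flatten [seq b.1 :: b.2 | b <- bs].

Definition block_heads bs : seq T := map fst bs.

Definition block_tails bs : seq T := flatten (map snd bs).

Lemma block_word_cons x v bs :
  block_word ((x, v) :: bs) = x :: v ++ block_word bs.
Proof. by []. Qed.

Lemma block_heads_cons x v bs :
  block_heads ((x, v) :: bs) = x :: block_heads bs.
Proof. by []. Qed.

Lemma block_tails_cons x v bs :
  block_tails ((x, v) :: bs) = v ++ block_tails bs.
Proof. by []. Qed.

Lemma block_decomposition (P : pred T) a :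
  exists u bs, [/\ a = u ++ block_word bs, filter P a = block_heads bs
                 & filter (predC P) a = u ++ block_tails bs].
Proof.
elim: a => [|x a [u [bs [aE headsE tailsE]]]]; first by exists [::], [::].
rewrite /=; case: (P x) => /=.
  by exists [::], ((x, u) :: bs); split=> //=; rewrite ?headsE //= ?aE ?tailsE.
by exists (x :: u), bs; split=> //=; rewrite ?tailsE ?aE.
Qed.

(** By disjointness and size, the letters of [alpha] are exactly those of [sigma] and [pi]. A
    subsequence of a duplicate-free word is a filter of it, so membership in [pi] separates the two
    words. *)
Lemma shuffle_blocks (sigma pi alpha : seq T) :
    uniq sigma -> uniq pi -> (forall x, x \in sigma -> x \notin pi) ->
    is_shuffle sigma pi alpha ->
  exists u bs, [/\ alpha = u ++ block_word bs, pi = block_heads bs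
                 & sigma = u ++ block_tails bs].
Proof.
move=> usigma upi disj /and4P[ualpha /eqP sz ssigma spi].
have /(subseq_uniqP ualpha) sigmaE := ssigma.
have /(subseq_uniqP ualpha) piE := spi.
have [|||_ memE] := @uniq_min_size _ (sigma ++ pi) alpha.
- rewrite cat_uniq usigma upi andbT; apply/hasPn => x xpi.
  by apply/negP => /disj; rewrite xpi.
- by move=> x; rewrite mem_cat => /orP[] /mem_subseq; apply.
- by rewrite sz size_cat.
have [u [bs [aE headsE tailsE]]] := block_decomposition (mem pi) alpha.
exists u, bs; split=> //; first by rewrite piE.
rewrite -tailsE sigmaE; apply: eq_in_filter => x; rewrite -memE mem_cat /=.
case xs: (x \in sigma); first by rewrite (disj x xs).
by move=> /= ->.
Qed.

(** * The differences f_i, with [bs] the blocks from pi_i on *)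

Definition des_excess bs : int :=
  (des (block_word bs))%:Z - (des (block_heads bs))%:Z.

(** With an empty run, the new head precedes the same letter in both words, so the excess is
    unchanged; inserting the run then adds between 0 and its length. This is the monotonicity of
    both f_i and f_i + p_i. *)
Lemma des_excess_cons b bs :
  des_excess bs <= des_excess (b :: bs) <= des_excess bs + (size b.2)%:Z.
Proof.
case: b => x v; rewrite /des_excess block_word_cons block_heads_cons /=.
have := des_insert_seq [:: x] v (block_word bs) => /=.
rewrite !(des_cons x (block_word bs)) !(des_cons x (block_heads bs)).
have -> : descent_before x (block_word bs) = descent_before x (block_heads bs).
  by case: bs => [|[]].
by lia.
Qed.

Lemma des_excess_ge0 bs : 0 <= des_excess bs.
Proof.
by elim: bs => // b bs IHbs; have := des_excess_cons b bs; lia.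
Qed.

Lemma des_excess_le bs : des_excess bs <= (size (block_tails bs))%:Z.
Proof.
elim: bs => // -[x v] bs IHbs; have := des_excess_cons (x, v) bs.
by rewrite block_tails_cons size_cat /=; lia.
Qed.

(** * Nonincreasing sequences and the induction over the blocks *)

Lemma path_ge (x : int) l :
  path >=%R x l = all (fun y => y <= x) l && sorted >=%R l.
Proof. by rewrite path_sortedE //; apply: rev_trans; apply: le_trans. Qed.

Lemma sorted_ge_rcons (x : int) l :
  sorted >=%R (rcons l x) = all (fun y => x <= y) l && sorted >=%R l.
Proof.
rewrite -[rcons l x]revK rev_rcons rev_sorted /= path_sortedE; last exact: le_trans.
by rewrite all_rev rev_sorted.
Qed.

Lemma sum_rcons (x : int) l : \sum_(y <- rcons l x) y = \sum_(y <- l) y + x.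
Proof. by rewrite -cats1 big_cat big_seq1. Qed.

(** Induction on [bs] for all [u], since deleting the first head merges its run into [u]. The bounds
    f + |u| and f are the two possible values of the first t, so they also yield the sortedness of
    the extended sequences. *)
Lemma Phi_blocks u bs (a := u ++ block_word bs) (sg := u ++ block_tails bs)
    (p := block_heads bs) (l := (Phi p a).1) (m := (Phi p a).2) :
    uniq a ->
  [/\ (size l)%:Z = (des a)%:Z - (des sg)%:Z /\
        (size m)%:Z = (size p)%:Z - (des a)%:Z + (des sg)%:Z,
      sorted >=%R l /\
        all (fun x => des_excess bs + (size u)%:Z <= x <= (size sg)%:Z) l,
      sorted >=%R m /\ all (fun x => 0 <= x <= des_excess bs) m
    & (maj a)%:Z =
      (\sum_(x <- l) x) + (\sum_(x <- m) x) + (maj sg)%:Z + (maj p)%:Z].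
Proof.
rewrite {}/l {}/m {}/a {}/sg {}/p.
elim: bs u => [|[x v] bs IHbs] u ua.
  rewrite /Phi /= !big_nil !cats0 [maj [::]]big_nil.
  by split=> //; rewrite ?addr0 ?add0r //; split; lia.
move: ua; rewrite block_word_cons block_heads_cons block_tails_cons.
set a := u ++ _; set p := block_heads bs => ua.
have a'E : [seq y <- a | y != x] = (u ++ v) ++ block_word bs.
  move: ua; rewrite uniq_catC /= mem_cat => /andP[/norP[xvG xu] _].
  rewrite /a filter_cat /= eqxx -catA -filter_cat.
  apply/all_filterP/allP => y; apply: contraTneq => ->.
  by rewrite mem_cat negb_or xu xvG.
have ua' : uniq ((u ++ v) ++ block_word bs) by rewrite -a'E filter_uniq.
have [[szl szm] [sl bl] [sm bm] majE] := IHbs _ ua'.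
rewrite -/p in szl szm sl bl sm bm majE.
rewrite Phi_cons a'E; set a' := (u ++ v) ++ _ in szl szm sl bl sm bm majE *.
case: (Phi p a') szl szm sl bl sm bm majE => l m /= szl szm sl bl sm bm majE.
have [e [desaE majaE]] := des_maj_insert u x (v ++ block_word bs).
rewrite -/a catA -/a' in desaE majaE.
have exc := des_excess_cons (x, v) bs; rewrite /= in exc.
(* These bound the new entry: from below by 0 in mu, from above by the length of sigma in lambda. *)
have exc0 := des_excess_ge0 bs.
have excm := des_excess_le ((x, v) :: bs).
rewrite block_tails_cons size_cat in excm.
have tE : (maj a)%:Z - (maj a')%:Z - (des (x :: p))%:Z
    = des_excess ((x, v) :: bs) + (e * size u)%:Z.
  by rewrite majaE /des_excess block_word_cons block_heads_cons -/p; lia.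
rewrite tE -!catA in majE szl szm bl *.
rewrite !size_cat in bl; rewrite !size_cat (maj_cons x p).
have bl' : all (fun y => des_excess ((x, v) :: bs) + (size u)%:Z <= y
                   <= (size u + (size v + size (block_tails bs)))%:Z)
             l.
  by apply: sub_all bl => y; lia.
have bm' : all (fun y => 0 <= y <= des_excess ((x, v) :: bs)) m.
  by apply: sub_all bm => y; lia.
(* The bit [e] of the insertion decides which of the two sequences receives the new entry. *)
have -> : (des a == (des a').+1) = e by case: (e) desaE; lia.
pose suml := \sum_(y <- l) y; pose summ := \sum_(y <- m) y.
rewrite -/suml -/summ in majE.
case: e desaE tE majaE => desaE tE majaE.
  rewrite size_rcons sorted_ge_rcons sl all_rcons bl' sm bm' /= sum_rcons -/suml -/summ.
  rewrite andbT; split; [lia | split | by [] | lia].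
    by apply: sub_all bl' => y; lia.
  by rewrite andbT; lia.
rewrite /= path_ge sl bl' sm bm' big_cons -/suml -/summ.
split; [lia | by [] | split | lia].
  by rewrite andbT; apply: sub_all bm' => y; lia.
by rewrite andbT; lia.
Qed.

End Blocks.

Theorem lemma3p5 (d : Order.disp_t) (T : orderType d) (m n r s k : nat)
    (sigma pi alpha : seq T) (lambda mu : seq int)
    (sigma_perm : uniq sigma) (sigma_size : size sigma = m)
    (sigma_des : des sigma = r)
    (pi_perm : uniq pi) (pi_size : size pi = n) (pi_des : des pi = s)
    (sigma_pi_disjoint : forall x : T, x \in sigma -> x \notin pi)
    (alpha_shuffle : is_shuffle sigma pi alpha) (alpha_des : des alpha = k)
    (Phi_alpha : Phi pi alpha = (lambda, mu)) :
  [/\ lambda \in Pseq (k%:Z - r%:Z) (k%:Z - s%:Z) m%:Z,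
      mu \in Pseq_le (n%:Z - k%:Z + r%:Z) (k%:Z - s%:Z)
    & (maj alpha)%:Z =
      (\sum_(x <- lambda) x) + (\sum_(x <- mu) x) + (maj sigma)%:Z + (maj pi)%:Z].
Proof.
have [ualpha _ _ _] := and4P alpha_shuffle.
have [u [bs [aE piE sE]]] :=
  shuffle_blocks sigma_perm pi_perm sigma_pi_disjoint alpha_shuffle.
(* Putting the initial run [u] in front adds between 0 and |u| descents, so k - s separates the
   bound on mu from the bound on lambda. *)
have exc : des_excess bs <= k%:Z - s%:Z <= des_excess bs + (size u)%:Z.
  have := des_insert_seq [::] u (block_word bs).
  by rewrite /= /des_excess -aE -piE; lia.
rewrite aE in ualpha; have := Phi_blocks ualpha.
rewrite -aE -piE -sE Phi_alpha /= alpha_des sigma_des pi_size sigma_size.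
case=> [[szl szm] [sl bl] [sm bm] majE]; split=> //; rewrite inE.
  by rewrite szl eqxx sl; apply: sub_all bl => x; lia.
by rewrite szm eqxx sm; apply: sub_all bm => x; lia.
Qed.
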